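(* Let $k\ge 3$ and let $G$ be a girth-regular graph of order $n$, valency $k$, even girth $g=2h$ and signature $\mathbf{a}=(a_1,\ldots,a_k)$. Then $$n\ge 2\frac{(k-1)^h-1}{k-2}+\max_{1\le i\le k}\left\lceil\frac{\left((k-1)^h-a_i\right)^2}{\sum_{j=1}^k a_j-3a_i+(k-1)^h-2\max\left(0,\left\lceil\frac{a_i^2}{2(k-1)^{h-1}}-\frac{a_i}{2}\right\rceil\right)}\right\rceil.$$
   Context: All graphs are simple, finite and connected, and valency $k>2$ is assumed throughout. For a $k$-regular graph of girth $g$, the signature of a vertex $v$ is the sequence $(a_1,\ldots,a_k)$, listed in non-decreasing order, of the numbers of $g$-cycles containing each of the $k$ edges incident with $v$; the graph is girth-regular if all vertices have the same signature, which is then called the signature of the graph. *)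

(* Defs.v *)
From mathcomp Require Import all_boot all_order all_algebra.

Set Implicit Arguments.
Unset Strict Implicit.
Unset Printing Implicit Defensive.

Import Order.TTheory GRing.Theory Num.Theory.

(* A simple graph is a symmetric irreflexive adjacency relation e on T. *)
Section Graphs.
Variables (T : finType) (e : rel T).
Implicit Types (u v w : T) (g k : nat) (s : seq T).

Definition connected_graph := (0 < #|T|)%N /\ forall u v, connect e u v.

Definition regular k := forall v, #|[set w | e v w]| = k.

Definition graph_cycle s := (2 < size s)%N && ucycleb e s.

(* Cycles are counted as subgraphs, hence identified with their edge sets:
   the 2g rotations and reflections of a vertex sequence are one g-cycle. *)
Definition cycle_edges s : {set {set T}} :=
  [set [set x; next s x] | x in s].

Definition cycles_of_length g : {set {set {set T}}} :=
  [set cycle_edges c | c : g.-tuple T & graph_cycle c].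

Definition has_girth g :=
  (exists2 s, graph_cycle s & size s = g) /\
  (forall s, graph_cycle s -> (g <= size s)%N).

Definition cycles_through_edge g u v : nat :=
  #|[set C in cycles_of_length g | [set u; v] \in C]|.

Definition vertex_signature g v : seq nat :=
  sort leq [seq cycles_through_edge g v w | w <- enum [set w | e v w]].

(* For nonempty T: all vertices have the same signature, and it is a. *)
Definition girth_regular_with_signature g (a : seq nat) :=
  forall v, vertex_signature g v = a.

End Graphs.

Local Open Scope ring_scope.

(* The denominator can only vanish together with the numerator (this happens
   when a_i = (k-1)^h, as for the Moore graphs); the convention x / 0 = 0 then
   makes the summand 0. *)
Definition excess k h (a : seq nat) (i : nat) : int :=
  let q : rat := k%:R - 1 in
  let ai : rat := (nth 0%N a i)%:R in
  Num.ceil ((q ^+ h - ai) ^+ 2 /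
    (\sum_(j < k) (nth 0%N a j)%:R - 3 * ai + q ^+ h
     - 2 * (Num.max 0 (Num.ceil (ai ^+ 2 / (2 * q ^+ h.-1) - ai / 2)))%:~R)).

(* Seeding the iterated maximum with the value at the first index makes it the
   plain maximum over 0 <= i < k when k > 0. *)
Definition max_excess k h (a : seq nat) : int :=
  \big[Num.max/excess k h a 0]_(i < k) excess k h a i.

(* Main.v *)
Require Import Defs.
From mathcomp Require Import all_boot all_order all_algebra.
From mathcomp Require Import zify ring lra.

(** Fix an arc u -> v with a_i girth cycles through it, and put q = k - 1.  The
vertices at distance less than h from the edge uv form a tree with
2 (q^h - 1) / (q - 1) vertices.  For a vertex z, let d(z) be the number of
neighbours of u lying on a path of length h from u to z.  A 2h-cycle through
the arc u -> w is determined by its vertex z opposite to u and the other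
neighbour of u on it, so the cycles through uw are counted by the sum of
d(z) - 1 over the z reached from u through w.  Double counting then gives
the sums of d and d^2 over the set X of vertices outside the tree:
q^h - a_i, and sum_j a_j - 3 a_i + q^h - 2 sum_z C(d(z) - 1, 2), the last sum
being over the q^(h-1) vertices z at distance h - 1 from v and h from u.
Cauchy-Schwarz on X bounds |X| from below, and Cauchy-Schwarz on the last
level of the tree bounds the sum of binomials from below. *)

Set Implicit Arguments.
Unset Strict Implicit.
Unset Printing Implicit Defensive.

Import Order.TTheory GRing.Theory Num.Theory.

(** * Disjoint unions and unordered pairs *)

Lemma card_bigcup_disjoint (I S : finType) (P : pred I) (F : I -> {set S}) :
  (forall i j, P i -> P j -> i != j -> [disjoint F i & F j]) ->
  #|\bigcup_(i | P i) F i| = \sum_(i | P i) #|F i|.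
Proof.
move=> disj; pose F' i := if P i then F i else set0.
rewrite big_mkcond -sum1_card (@partition_disjoint_bigcup _ _ _ _ _ F') => [|i j].
  rewrite [RHS]big_mkcond; apply: eq_bigr => i _; rewrite sum1_card /F'.
  by case: ifP; rewrite ?cards0.
rewrite /F' => neq_ij; case: ifP => Pi; last by rewrite disjoints_subset sub0set.
by case: ifP => Pj; [apply: disj | rewrite disjoints_subset setC0 subsetT].
Qed.

Lemma set2_inj (T : finType) (u w x y : T) :
  [set u; w] = [set x; y] -> u = x /\ w = y \/ u = y /\ w = x.
Proof.
move=> /setP E; have := (E u, E w, E x, E y).
rewrite !inE !eqxx /= !orbT => -[[[/esym/orP u_xy /esym/orP w_xy] x_uw] y_uw].
case: u_xy w_xy x_uw y_uw => /eqP-> [] /eqP->; rewrite ?eqxx ?orbb ?orbT.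
- by move=> _ /eqP->; left.
- by left.
- by right.
- by move=> /eqP->; left.
Qed.

(** * Cycles as edge sets versus cycles as vertex sequences *)

Section CycleEdges.
Variable T : finType.
Implicit Types s t : seq T.

Lemma next_nthS x0 s i :
  uniq s -> (i.+1 < size s)%N -> next s (nth x0 s i) = nth x0 s i.+1.
Proof.
move=> Us lti; rewrite next_nth mem_nth ?index_uniq //; do ?exact: ltnW.
by case: s Us lti => //= y s _ lti; apply: set_nth_default.
Qed.

Lemma cycle_edges_rot n s : uniq s -> cycle_edges (rot n s) = cycle_edges s.
Proof.
move=> Us; apply/setP=> A; apply/imsetP/imsetP => -[x xs ->]; exists x;
  by rewrite ?next_rot // ?mem_rot // in xs *.
Qed.

Lemma cycle_edges_rev s : uniq s -> cycle_edges (rev s) = cycle_edges s.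
Proof.
move=> Us; apply/setP=> A; apply/imsetP/imsetP => -[x xs ->].
  exists (prev s x); first by rewrite mem_prev -mem_rev.
  by rewrite next_prev // next_rev // setUC.
exists (next s x); first by rewrite mem_rev mem_next.
by rewrite next_rev // prev_next // setUC.
Qed.

(** The first two vertices fix the base point and the direction. Inductively, the edge of [s]
    leaving position [j.+1] is one of the two edges of [t] at that vertex; the other one leads back
    to position [j], which [uniq s] excludes. *)
Lemma cycle_edges_inj x0 s t :
  uniq s -> uniq t -> size s = size t ->
  nth x0 s 0 = nth x0 t 0 -> nth x0 s 1 = nth x0 t 1 ->
  cycle_edges s = cycle_edges t -> s = t.
Proof.
move=> Us Ut Est E0 E1 E; apply: (@eq_from_nth _ x0) => // i.
suff H j : (j.+1 < size s)%N -> nth x0 s j = nth x0 t j /\ nth x0 s j.+1 = nth x0 t j.+1.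
  by case: i => // i /H[].
elim: j => // j IH ltj; have ltj1 := ltnW ltj; have ltj0 := ltnW ltj1.
have [//|Ej Ej1] := IH; split=> //.
have : [set nth x0 s j.+1; nth x0 s j.+2] \in cycle_edges t.
  by rewrite -E -(@next_nthS x0 s j.+1) //; apply: imset_f; apply: mem_nth.
case/imsetP => x xt Exy.
have s_neq : nth x0 s j.+2 != nth x0 s j.+1 by rewrite nth_uniq // gtn_eqF.
have s_neq2 : nth x0 s j.+2 != nth x0 s j by rewrite nth_uniq // gtn_eqF.
have : nth x0 s j.+1 \in [set x; next t x] by rewrite -Exy set21.
have : nth x0 s j.+2 \in [set x; next t x] by rewrite -Exy set22.
rewrite !inE => in2 /orP[] /eqP Ex.
  move: in2; rewrite -Ex (negPf s_neq) Ej1 next_nthS -?Est //.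
  by move/eqP.
have Ex2 : x = nth x0 s j.
  by apply: (can_inj (prev_next Ut)); rewrite Ej next_nthS -?Est // -Ej1.
by move: in2; rewrite -Ex Ex2 (negPf s_neq) (negPf s_neq2).
Qed.

Lemma rotate_graph_cycle (e : rel T) g (c : g.-tuple T) x : graph_cycle e c -> x \in c ->
  exists d : g.-tuple T,
    [/\ graph_cycle e d, nth x d 0 = x, nth x d 1 = next c x & cycle_edges d = cycle_edges c].
Proof.
case/and3P => c2 ec Uc xc; exists [tuple of rot (index x c) c].
have d0 : nth x (rot (index x c) c) 0 = x by rewrite rot_index.
split=> //=.
- by rewrite /graph_cycle /ucycleb size_rot c2 rot_cycle rot_uniq ec.
- by rewrite -next_nthS ?rot_uniq ?size_rot ?d0 ?next_rot //; apply: ltnW.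
- exact: cycle_edges_rot.
Qed.

(** Among the rotations and reflections of a cycle through the edge, exactly one starts with [u],
    [w]. Edge sets can thus be traded for sequences. *)
Lemma cycles_through_edgeE (e : rel T) (e_sym : symmetric e) g u w :
  cycles_through_edge e g u w =
  #|[set c : g.-tuple T | [&& graph_cycle e c, nth u c 0 == u & nth u c 1 == w]]|.
Proof.
rewrite /cycles_through_edge.
rewrite -(@card_in_imset _ _ (fun c : g.-tuple T => cycle_edges c)); last first.
  move=> c d; rewrite !inE => /and3P[/and3P[_ _ Uc] /eqP c0 /eqP c1].
  case/and3P => /and3P[_ _ Ud] /eqP d0 /eqP d1 E; apply: val_inj => /=.
  by apply: (@cycle_edges_inj u); rewrite ?size_tuple ?c0 ?c1.
congr #|pred_of_set _|; apply/setP => C; rewrite !inE; apply/andP/imsetP.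
  case=> /imsetP[c c_cycle ->]; rewrite inE in c_cycle.
  case/imsetP => x xc Euw.
  suff [d [d_cycle d0 d1 Ed]] : exists d : g.-tuple T,
      [/\ graph_cycle e d, nth u d 0 = u, nth u d 1 = w & cycle_edges d = cycle_edges c].
    by exists d; rewrite ?inE ?d_cycle ?d0 ?d1 ?eqxx.
  have [c3 ec Uc] := and3P c_cycle.
  (* If the cycle runs from [w] to [u], it is reversed before being rotated. *)
  case: (set2_inj Euw) => -[-> ->]; first exact: rotate_graph_cycle.
  have rev_c : graph_cycle e (rev c).
    rewrite /graph_cycle /ucycleb size_rev c3 rev_uniq Uc andbT rev_cycle.
    by rewrite -(eq_cycle (e := e)) // => y z; rewrite e_sym.
  have [|d [? d0 d1 Ed]] := @rotate_graph_cycle e g [tuple of rev c] (next c x) rev_c.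
    by rewrite mem_rev mem_next.
  exists d; split=> //; last by rewrite Ed cycle_edges_rev.
  by rewrite d1 next_rev // prev_next.
case=> c; rewrite inE => /and3P[c_cycle /eqP c0 /eqP c1] ->.
split; first by apply: imset_f; rewrite inE.
case/and3P: c_cycle => c2 _ Uc.
rewrite -{1}c0 -c1 -next_nthS //; last exact: ltnW.
by apply: imset_f; rewrite mem_nth //; do 2!apply: ltnW.
Qed.

End CycleEdges.

(** * Uniqueness of short paths and the vertices reached from an arc *)

Section Girth.
Variables (T : finType) (e : rel T).
Hypotheses (e_sym : symmetric e) (e_irr : irreflexive e).

Lemma cycle_two_paths x a z b :
  cycle e (x :: rcons a z ++ rev b) = path e x (rcons a z) && path e x (rcons b z).
Proof.
rewrite /= rcons_cat cat_path last_rcons; congr (_ && _).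
have := rev_path e x (rcons b z).
rewrite last_rcons belast_rcons rev_cons => ->.
by apply: eq_path => y w; rewrite e_sym.
Qed.

Variable g : nat.
Hypothesis girth_ge : forall s, graph_cycle e s -> (g <= size s)%N.

(** After the common initial part is removed, two distinct simple paths with the same ends enclose a
    cycle no longer than their total length. *)
Lemma uniq_path_inj x p1 p2 :
  path e x p1 -> uniq (x :: p1) -> path e x p2 -> uniq (x :: p2) ->
  last x p1 = last x p2 -> (size p1 + size p2 < g)%N -> p1 = p2.
Proof.
elim: p1 p2 x => [|y p1 IH] [|y2 p2] x //.
- by move=> _ _ _ /= /andP[/negP xN _] xE; case: xN; rewrite xE mem_last.
- by move=> _ /= /andP[/negP xN _] _ _ xE; case: xN; rewrite -xE mem_last.
have [<-|neq_y] := eqVneq y y2.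
  move=> /= /andP[_ P1] /andP[_ U1] /andP[_ P2] /andP[_ U2] L S.
  by congr (_ :: _); apply: IH P1 U1 P2 U2 L _; lia.
move=> P1 U1 P2 U2 L S; exfalso.
have meet : has (mem (y2 :: p2)) (y :: p1).
  apply/hasP; exists (last y p1); first exact: mem_last.
  by move: L => /= ->; apply: mem_last.
have : head x (y :: p1) != head x (y2 :: p2) by [].
move: (y :: p1) (y2 :: p2) meet P1 U1 P2 U2 S => q1 q2 {L neq_y}.
(* [z] is the first vertex of [q1] that lies on [q2], so the segments from [x] to [z] have disjoint
   interiors. *)
case/split_find => z a s1 z_in a_out P1 U1 P2 U2.
have {}z_in : z \in q2 by [].
case/splitPr: z_in a_out P2 U2 => b s2 a_out P2 U2 S neq_head.
have C : graph_cycle e (x :: rcons a z ++ rev b).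
  apply/andP; split.
    (* If [a] and [b] were both empty, both paths would start with [z], against the distinct
       heads. *)
    case: (a) (b) neq_head => [|? ?] [|? ?] //=; last by rewrite ?size_cat ?size_rcons; lia.
    - by rewrite eqxx.
    - by rewrite size_rev.
    - by rewrite size_cat size_rcons.
  apply/andP; split.
    rewrite cycle_two_paths; move: P1 P2; rewrite -cat_rcons !cat_path.
    by move=> /andP[-> _] /andP[-> _].
  move: U1 U2; rewrite -!cat_rcons -!cat_cons !cat_uniq.
  move=> /and3P[-> _ _] /and3P[Ub _ _].
  rewrite rev_uniq; move: Ub; rewrite /= mem_rcons rcons_uniq in_cons negb_or.
  case/andP=> /andP[_ x_b] /andP[z_b ->]; rewrite andbT.
  apply/hasPn => w; rewrite mem_rev => w_b.
  rewrite /= in_cons mem_rcons in_cons !negb_or; apply/and3P; split.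
  - by apply: contraNneq x_b => <-.
  - by apply: contraNneq z_b => <-.
  - by apply: contra a_out => w_a; apply/hasP; exists w; rewrite //= mem_cat w_b.
have := girth_ge C.
by move: S; rewrite /= !size_cat size_rev !size_rcons /=; lia.
Qed.

(** The endpoints of the non-backtracking walks that start with the arc x -> y
and make j further steps. *)
Fixpoint ends x y j : {set T} :=
  if j is j'.+1 then \bigcup_(z in [set z | e y z] :\ x) ends y z j' else [set y].

(** Below the girth, a walk that does not backtrack is a simple path, so [ends] can be treated
    through paths. *)
Lemma endsP x y j z : e x y -> (j.+1 < g)%N ->
  reflect (exists p, [/\ size p = j, path e x (y :: p), uniq (x :: y :: p)
                        & last y p = z])
          (z \in ends x y j).
Proof.
elim: j x y => [|j IH] x y exy ltg /=.
  rewrite inE; apply: (iffP eqP) => [->|[p [/size0nil-> _ _ <-]] //].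
  exists [::]; split; rewrite //= ?exy // inE andbT.
  by apply: contraTneq exy => ->; rewrite e_irr.
apply: (iffP bigcupP) => [[y2]|[[|y2 p] [//= [size_p] path_p uniq_p last_p]]].
  rewrite !inE => /andP[y2x ey]; case/(IH _ _ ey) => [|p [sp pp up lp]]; first lia.
  exists (y2 :: p); split=> //; first by rewrite /= sp.
    by rewrite [path _ _ _]/= exy.
  apply/andP; split; last exact: up.
  rewrite in_cons negb_or; apply/andP; split.
    by apply: contraTneq exy => ->; rewrite e_irr.
  (* A return to [x] would give a path from [y] to [x] besides the single edge; by uniqueness it is
     that edge, so the walk backtracks. *)
  apply/negP => x_p; case/splitPr Ep : _ / x_p => [p1 p2].
  have P1 : path e y (rcons p1 x).
    by move: pp; rewrite Ep -cat_rcons cat_path => /andP[].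
  have U1 : uniq (y :: rcons p1 x).
    by move: up; rewrite Ep -cat_rcons -cat_cons cat_uniq => /andP[].
  have E : rcons p1 x = [:: x].
    apply: (uniq_path_inj P1 U1) => /=.
    - by rewrite e_sym exy.
    - by rewrite inE andbT; apply: contraTneq exy => ->; rewrite e_irr.
    - by rewrite last_rcons.
    - have := congr1 size Ep; rewrite /= size_rcons size_cat sp /=; lia.
  by case: p1 Ep E {P1 U1} => [[/eqP]|? []] //; rewrite (negPf y2x).
move: path_p uniq_p => /and3P[_ eyy2 pp] /and3P[x_out y_out up].
exists y2; first by rewrite !inE eyy2 andbT; apply: contraNneq x_out => ->; rewrite !inE eqxx orbT.
apply/IH => //; first lia.
by exists p; split; rewrite /= ?eyy2 ?y_out.
Qed.

Variable q : nat.
Hypothesis e_reg : regular e q.+1.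

(** Each step offers [q] continuations. Those through different neighbours of [y] never meet, as two
    paths of length at most [j] from [y] would then have a common end. *)
Lemma card_ends x y j : e x y -> (j.*2 < g)%N -> (j.+1 < g)%N ->
  #|ends x y j| = (q ^ j)%N.
Proof.
elim: j x y => [|j IH] x y exy ltg ltg1; first by rewrite cards1.
have disj z1 z2 : z1 \in [set z | e y z] :\ x -> z2 \in [set z | e y z] :\ x ->
    z1 != z2 -> [disjoint ends y z1 j & ends y z2 j].
  rewrite !inE => /andP[_ e1] /andP[_ e2]; apply: contraR => /pred0Pn[w].
  case/andP=> /(endsP _ e1)[|p1 [s1 P1 U1 L1]]; first lia.
  case/(endsP _ e2)=> [|p2 [s2 P2 U2 L2]]; first lia.
  suff [->] : z1 :: p1 = z2 :: p2 by [].
  apply: uniq_path_inj P1 U1 P2 U2 (etrans L1 (esym L2)) _.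
  by rewrite /= s1 s2; lia.
rewrite card_bigcup_disjoint // (eq_bigr (fun=> q ^ j)%N) => [|z]; last first.
  by rewrite !inE => /andP[_ eyz]; apply: IH => //; lia.
rewrite sum_nat_const expnS; congr (_ * _)%N.
have := cardsD1 x [set z | e y z]; rewrite e_reg inE e_sym exy.
by rewrite add1n; case=> ->; apply: eq_card => z.
Qed.

End Girth.

Arguments ends : simpl never.

(** * Girth cycles through an arc, counted by the vertex opposite to its tail *)

(** To make the predecessors of the half-girth explicit, h.+2 stands for the
paper's h. *)
Section EvenGirth.
Variables (T : finType) (e : rel T).
Hypotheses (e_sym : symmetric e) (e_irr : irreflexive e).
Variable h : nat.
Hypothesis girth_ge : forall s, graph_cycle e s -> (2 * h.+2 <= size s)%N.

Lemma even_cycle_split (c : seq T) : size c = (2 * h.+2)%N ->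
  exists x y a z y' b,
    [/\ c = x :: rcons (y :: a) z ++ rev (y' :: b), size a = h & size b = h].
Proof.
case: c => [|x [|y c]] //= sc.
have {}sc : size c = (h.+1 + h.+1)%N by lia.
case Er: (rev (drop h.+1 c)) => [|y' b].
  by have := congr1 size Er; rewrite size_rev size_drop sc addnK.
case/lastP Ea: (take h.+1 c) => [|a z].
  by have := congr1 size Ea; rewrite size_takel ?sc ?leq_addr.
exists x, y, a, z, y', b; split.
- by rewrite -Er revK /= -Ea cat_take_drop.
- by have := congr1 size Ea; rewrite size_takel ?sc ?leq_addr // size_rcons => -[].
- by have := congr1 size Er; rewrite size_rev size_drop sc addnK => -[].
Qed.

(** Two paths of length h.+2 between u and z with different first steps share no
interior vertex, since their initial parts up to it would violate
[uniq_path_inj]. *)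
Lemma even_cycleP u y a z y' b : size a = h -> size b = h ->
  reflect
    [/\ y' != y,
        path e u (y :: rcons a z) /\ uniq (u :: y :: rcons a z) &
        path e u (y' :: rcons b z) /\ uniq (u :: y' :: rcons b z)]
    (graph_cycle e (u :: rcons (y :: a) z ++ rev (y' :: b))).
Proof.
move=> sa sb; rewrite /graph_cycle /ucycleb cycle_two_paths //.
have -> : uniq (u :: rcons (y :: a) z ++ rev (y' :: b)) =
    uniq (u :: rcons (y :: a) z) && (~~ has (mem (u :: rcons (y :: a) z)) (y' :: b)
    && uniq (y' :: b)).
  by rewrite -cat_cons cat_uniq rev_uniq has_rev.
have -> : (2 < size (u :: rcons (y :: a) z ++ rev (y' :: b)))%N.
  by rewrite /= size_cat size_rcons size_rev /=; lia.
apply: (iffP and3P) => [[_ /andP[P1 P2] /and3P[U1 disj U2]]|].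
  have notin x : x \in u :: rcons (y :: a) z -> x \notin y' :: b.
    by move=> x1; apply: contra disj => x2; apply/hasP; exists x.
  split; [|by split|split=> //].
    by apply: contraTneq (notin y _) => [->|]; rewrite ?negbK !inE eqxx ?orbT.
  rewrite cons_uniq -rcons_cons mem_rcons inE rcons_uniq negb_or U2 !notin //.
  - rewrite !andbT; apply: contraTneq U1 => ->.
    by rewrite /= inE mem_rcons inE eqxx orbT.
  - by rewrite inE mem_rcons inE eqxx orbT.
  - by rewrite inE eqxx.
case=> neq_y [P1 U1] [P2 U2]; split=> //; first by rewrite P1 P2.
have [u_out z_out Ub] : [/\ u \notin y' :: b, z \notin y' :: b & uniq (y' :: b)].
  move: U2; rewrite /= !inE !mem_rcons !inE !negb_or rcons_uniq (eq_sym z).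
  by case/andP => /and3P[-> _ ->] /and3P[/andP[-> ->] -> ->].
apply/and3P; split=> //; apply/hasPn => x x_b.
change (x \notin u :: rcons (y :: a) z).
rewrite in_cons mem_rcons in_cons; apply/norP; split; last apply/norP; last split.
- by apply: contraNneq u_out => <-.
- by apply: contraNneq z_out => <-.
apply/negP => x_a.
have init (s : seq T) : x \in s -> size s = h.+1 -> path e u (rcons s z) -> uniq (u :: rcons s z) ->
    exists t, [/\ path e u (rcons t x), uniq (u :: rcons t x), (size (rcons t x) <= h.+1)%N
                & head u s = head u (rcons t x)].
  case/splitPr => s1 s2 size_s; rewrite -cat_rcons rcons_cat cat_path => /andP[Ps _].
  rewrite -cat_cons cat_uniq => /andP[Us _]; exists s1; split=> //.
    by rewrite size_rcons -size_s size_cat /= addnS ltnS leq_addr.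
  by case: (s1).
have [|//|//|s [Ps Us ss hs]] := init _ x_a; first by rewrite /= sa.
have [|//|//|t [Pt Ut st ht]] := init _ x_b; first by rewrite /= sb.
case/eqP: neq_y; rewrite -[y']/(head u (y' :: b)) ht -[y]/(head u (y :: a)) hs.
congr (head u _); apply: (uniq_path_inj e_sym girth_ge Pt Ut Ps Us).
  by rewrite !last_rcons.
by apply: leq_ltn_trans (leq_add st ss) _; rewrite addnn mul2n ltn_double.
Qed.

(** The size of this set is the number d(z) of the opening comment. *)
Definition branches u z := [set w | e u w & z \in ends e u w h.+1].

Lemma cycles_through_edge_branches u w : e u w ->
  cycles_through_edge e (2 * h.+2) u w =
  \sum_(z in ends e u w h.+1) #|branches u z :\ w|.
Proof.
move=> euw; have lt_h : (h.+2 < 2 * h.+2)%N by lia.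
rewrite cycles_through_edgeE //.
have end_pathP v z (euv : e u v) := endsP e_sym e_irr girth_ge z euv lt_h.
(* The opposite vertex and the other neighbour of [u]. They determine the cycle because each of its
   halves is a unique short path. *)
pose f (c : (2 * h.+2).-tuple T) := (nth u c h.+2, last u c).
have fE c x y a z y' b : tval c = x :: rcons (y :: a) z ++ rev (y' :: b) -> size a = h ->
    f c = (z, y').
  move=> Ec sa; rewrite /f Ec last_cons last_cat rev_cons last_rcons; congr (_, _).
  by rewrite cat_rcons /= nth_cat /= sa ltnn subnn.
have split_c (c : (2 * h.+2).-tuple T) :
    graph_cycle e c -> nth u c 0 = u -> nth u c 1 = w ->
    exists a z y' b, [/\ tval c = u :: rcons (w :: a) z ++ rev (y' :: b),
      size a = h, size b = h & f c = (z, y')].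
  have [x [y [a [z [y' [b [Ec sa sb]]]]]]] := even_cycle_split (size_tuple c).
  move=> _; rewrite Ec /= => <- <-; exists a, z, y', b; split=> //.
  exact: fE Ec sa.
rewrite -(@card_in_imset _ _ f); last first.
  move=> c d; rewrite !inE => /and3P[Cc /eqP c0 /eqP c1] /and3P[Cd /eqP d0 /eqP d1].
  have [a [z [y' [b [Ec sa sb ->]]]]] := split_c c Cc c0 c1.
  have [a2 [z2 [y2' [b2 [Ed sa2 sb2 ->]]]]] := split_c d Cd d0 d1.
  case=> Ez Ey; subst y2' z2; apply: val_inj => /=.
  move: Cc Cd; rewrite Ec Ed => /even_cycleP[] // _ [Pa Ua] [Pb Ub].
  case/even_cycleP=> // _ [Pa2 Ua2] [Pb2 Ub2].
  have tail_inj v s t : size s = h -> size t = h ->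
      path e u (v :: rcons s z) -> uniq (u :: v :: rcons s z) ->
      path e u (v :: rcons t z) -> uniq (u :: v :: rcons t z) -> s = t.
    move=> ss st /andP[_ Ps] /andP[_ Us] /andP[_ Pt] /andP[_ Ut].
    suff /rcons_inj[] : rcons s z = rcons t z by [].
    apply: (uniq_path_inj e_sym girth_ge Ps Us Pt Ut); first by rewrite !last_rcons.
    by rewrite !size_rcons ss st addnn mul2n ltn_double.
  by rewrite (tail_inj w a a2) // (tail_inj y' b b2).
have -> : \sum_(z in ends e u w h.+1) #|branches u z :\ w| =
   #|[set p : T * T | (p.1 \in ends e u w h.+1) && (p.2 \in branches u p.1 :\ w)]|.
  by under eq_bigr do rewrite -sum1_card; rewrite pair_big_dep sum1dep_card.
congr #|pred_of_set _|; apply/setP => -[z y']; rewrite [RHS]inE /= !inE.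
apply/imsetP/and4P.
  case=> c; rewrite inE => /and3P[Cc /eqP c0 /eqP c1].
  have [a [z2 [y2 [b [Ec sa sb ->]]]]] := split_c c Cc c0 c1.
  case=> -> ->; move: Cc; rewrite Ec => /even_cycleP[] // neq_y [Pa Ua] [Pb Ub].
  case/andP: (Pb) => euy _; split=> //; apply/end_pathP => //.
    by exists (rcons a z2); split; rewrite ?size_rcons ?last_rcons ?sa.
  by exists (rcons b z2); split; rewrite ?size_rcons ?last_rcons ?sb.
case=> /(end_pathP _ _ euw)[p [sp Pp Up Lp]].
move=> neq_y euy /(end_pathP _ _ euy)[p' [sp' Pp' Up' Lp']].
case/lastP: p sp Pp Up Lp => [//|a z2]; rewrite size_rcons last_rcons => -[sa] Pa Ua ?.
case/lastP: p' sp' Pp' Up' Lp' => [//|b z3]; rewrite size_rcons last_rcons => -[sb] Pb Ub ?.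
subst z2 z3.
have sc : size (u :: rcons (w :: a) z ++ rev (y' :: b)) == (2 * h.+2)%N.
  by rewrite /= size_cat size_rcons size_rev /= sa sb; apply/eqP; lia.
exists (Tuple sc); last by rewrite (fE _ u w a z y' b).
by rewrite inE /= !eqxx !andbT; apply/even_cycleP.
Qed.

Lemma card_branches u w z : z \in ends e u w h.+1 -> e u w ->
  #|branches u z| = #|branches u z :\ w|.+1.
Proof. by move=> zw euw; rewrite (cardsD1 w) inE euw zw add1n. Qed.

(** Double counting of the pairs [(w, z)] with [w] in [branches u z]; it is used with the weights 1
    and d(z). *)
Lemma sum_branches u (f : T -> nat) :
  \sum_z #|branches u z| * f z = \sum_(w | e u w) \sum_(z in ends e u w h.+1) f z.
Proof.
under eq_bigr do rewrite -sum_nat_const.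
rewrite (exchange_big_dep (e u)) => [|z w _] /=; last by rewrite inE => /andP[].
by apply: eq_bigr => w euw; apply: eq_bigl => z; rewrite inE euw.
Qed.

(** * The tree around an edge *)

Definition tree u v :=
  \bigcup_(p : bool * 'I_h.+2) if p.1 then ends e v u p.2 else ends e u v p.2.

(** Both sides of the tree are viewed from [u]: the path passes through [v] exactly on the side of
    [v], where it is one edge longer. Hence side and level can be read off the path. *)
Lemma tree_path u v (p : bool * 'I_h.+2) x : e u v ->
  x \in (if p.1 then ends e v u p.2 else ends e u v p.2) ->
  exists s, [/\ path e u s /\ uniq (u :: s), last u s = x, size s = (~~ p.1 + p.2)%N
              & (v \in s) = ~~ p.1].
Proof.
case: p => b i euv; have lti : (i.+1 < 2 * h.+2)%N by have := ltn_ord i; lia.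
have evu : e v u by rewrite e_sym.
case: b => /=.
  case/(endsP e_sym e_irr girth_ge _ evu lti) => s [ss /andP[_ Ps] /andP[v_s Us] Ls].
  exists s; split=> //.
  by move: v_s; rewrite in_cons negb_or => /andP[_ /negPf].
case/(endsP e_sym e_irr girth_ge _ euv lti) => s [ss Ps Us Ls].
by exists (v :: s); split; rewrite ?in_cons ?eqxx //= ss.
Qed.

Variable q : nat.
Hypothesis e_reg : regular e q.+1.

Lemma card_tree u v : e u v -> #|tree u v| = \sum_(i < h.+2) 2 * q ^ i.
Proof.
move=> euv; have evu : e v u by rewrite e_sym.
have card_F w x (i : 'I_h.+2) : e w x -> #|ends e w x i| = (q ^ i)%N.
  move=> ewx; have lti := ltn_ord i.
  by rewrite (card_ends e_sym e_irr girth_ge e_reg) //; lia.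
rewrite card_bigcup_disjoint => [|p1 p2 _ _].
  rewrite -(pair_bigA _ (fun b (i : 'I_h.+2) => #|if b then ends e v u i else ends e u v i|)) /=.
  rewrite big_bool /= -big_split /=; apply: eq_bigr => i _.
  by rewrite !card_F // addnn mul2n.
apply: contraR => /pred0Pn[x /andP[x1 x2]].
have [s1 [[P1 U1] L1 S1 V1]] := tree_path euv x1.
have [s2 [[P2 U2] L2 S2 V2]] := tree_path euv x2.
(* Both paths have length at most [h.+2], with equality twice only if both indices are
   [(false, ord_max)]. Assuming the indices distinct makes the bound on the total length strict. *)
apply/eqP; apply: contraTeq isT => neq_p.
suff Es : s1 = s2.
  case/eqP: neq_p; case: p1 p2 S1 S2 V1 V2 {x1 x2} => b1 i1 [b2 i2] /= S1 S2.
  rewrite Es => -> /negb_inj Eb; subst b2; congr (_, _); apply: ord_inj.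
  by apply: (@addnI (~~ b1)); rewrite -S1 -S2 Es.
apply: (uniq_path_inj e_sym girth_ge P1 U1 P2 U2); first by rewrite L1.
rewrite S1 S2; case: p1 p2 neq_p {S1 S2 V1 V2 x1 x2} => b1 i1 [b2 i2] /=.
have := ltn_ord i1; have := ltn_ord i2.
rewrite xpair_eqE -val_eqE /= {P1 U1 L1 P2 U2 L2}.
by case: b1 b2 => [] [] /=; lia.
Qed.

(** A vertex of the tree reached from u in h.+2 steps is on its last level on the
side of v, since any other tree vertex is joined to u by a shorter path. *)
Lemma sum_outside_tree u v (F : nat -> nat) : e u v -> F 0 = 0 ->
  \sum_z F #|branches u z| =
  \sum_(z in ~: tree u v) F #|branches u z| +
  \sum_(z in ends e u v h.+1) F #|branches u z|.
Proof.
move=> euv F0.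
have sub_tree : {subset ends e u v h.+1 <= tree u v}.
  by move=> z zv; apply/bigcupP; exists (false, ord_max).
rewrite (bigID (mem (tree u v))) [RHS]addnC /=; congr (_ + _); last first.
  by apply: eq_bigl => z; rewrite inE.
rewrite (bigID (mem (ends e u v h.+1))) /= [X in _ + X]big1 ?addn0 => [|z /andP[z_tree z_v]].
  by apply: eq_bigl => z; apply: andb_idl => /sub_tree.
suff -> : branches u z = set0 by rewrite cards0.
apply/setP => w; rewrite !inE; apply/negbTE/negP => /andP[euw z_w].
have [w_v|neq_w] := eqVneq w v; first by rewrite -w_v z_w in z_v.
have lt_h : (h.+2 < 2 * h.+2)%N by lia.
case/(endsP e_sym e_irr girth_ge _ euw lt_h): z_w => s [ss Ps Us Ls].
case/bigcupP: z_tree => p _ zp; have [t [[Pt Ut] Lt St Vt]] := tree_path euv zp.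
have ltp := ltn_ord p.2.
have lt_t : (size t < h.+2)%N.
  rewrite St; case: p {Vt St} zp ltp => [[] i] //= zi.
  rewrite ltnS leq_eqVlt => /orP[/eqP Ei|//].
  by rewrite Ei (negPf z_v) in zi.
have Est : w :: s = t.
  apply: (uniq_path_inj e_sym girth_ge Ps Us Pt Ut); first by rewrite Lt.
  by rewrite /= ss mul2n -addnn ltn_add2l.
by move: lt_t; rewrite -Est /= ss ltnn.
Qed.

Lemma sum_neighbours_const u c : \sum_(w | e u w) c = (q.+1 * c)%N.
Proof.
rewrite sum_nat_const -(e_reg u); congr (_ * _)%N.
by apply: eq_card => w; rewrite inE.
Qed.

Lemma card_last_level u w : e u w -> #|ends e u w h.+1| = (q ^ h.+1)%N.
Proof. by move=> euw; rewrite (card_ends e_sym e_irr girth_ge e_reg) //; lia. Qed.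

(** * First and second moments of d(z) outside the tree *)

Section Counts.
Variables u v : T.
Hypothesis euv : e u v.
Local Notation a w := (cycles_through_edge e (2 * h.+2) u w).
Local Notation X := (~: tree u v).
Local Notation n z := #|branches u z :\ v|.

Lemma sum_branches_last_level w : e u w ->
  \sum_(z in ends e u w h.+1) #|branches u z| = a w + q ^ h.+1.
Proof.
move=> euw; rewrite cycles_through_edge_branches // -(card_last_level euw).
rewrite -sum1_card -big_split /=; apply: eq_bigr => z zw.
by rewrite (card_branches zw euw) addn1.
Qed.

(** The sum of d over all vertices is [q.+1 * q ^ h.+1], of which the last level on the side of [v]
    takes [a v + q ^ h.+1]. *)
Lemma sum_degrees_outside : \sum_(z in X) #|branches u z| + a v = q ^ h.+2.
Proof.
have := sum_branches u (fun=> 1).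
under eq_bigr do rewrite muln1.
rewrite (@sum_outside_tree u v id) // sum_branches_last_level //.
rewrite [X in _ = X](eq_bigr (fun=> q ^ h.+1)%N) => [|w euw].
  by rewrite sum_neighbours_const (expnS _ h.+1); lia.
by rewrite -(card_last_level euw) -sum1_card.
Qed.

Lemma sum_degrees_sq_outside :
  \sum_(z in X) #|branches u z| ^ 2 + \sum_(z in ends e u v h.+1) n z ^ 2 + 2 * a v =
  \sum_(w | e u w) a w + q ^ h.+2.
Proof.
have := sum_branches u (fun z => #|branches u z|).
under eq_bigr do rewrite mulnn.
rewrite (@sum_outside_tree u v (fun m => m ^ 2)) //.
rewrite [X in _ = X](eq_bigr (fun w => a w + q ^ h.+1)%N); last exact: sum_branches_last_level.
rewrite big_split /= sum_neighbours_const.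
(* On this level d(z) is [n z] plus 1, and the [n z] add up to [a v]; the square is expanded. *)
have -> : \sum_(z in ends e u v h.+1) #|branches u z| ^ 2 =
    \sum_(z in ends e u v h.+1) n z ^ 2 + 2 * a v + q ^ h.+1.
  rewrite cycles_through_edge_branches // -(card_last_level euv) big_distrr /=.
  rewrite -sum1_card -!big_split /=; apply: eq_bigr => z zv.
  by rewrite (card_branches zv euv); lia.
rewrite (expnS _ h.+1); lia.
Qed.

End Counts.

End EvenGirth.

(** * Cauchy-Schwarz and the resulting bound on the quotient *)

Lemma sum_sqr_le (I : finType) (A : {pred I}) (f : I -> nat) :
  (\sum_(i in A) f i) ^ 2 <= #|A| * \sum_(i in A) f i ^ 2.
Proof.
have : \sum_(i in A) \sum_(j in A) 2 * (f i * f j) <=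
    \sum_(i in A) \sum_(j in A) (f i ^ 2 + f j ^ 2).
  by apply: leq_sum => i _; apply: leq_sum => j _; apply: nat_Cauchy.
under eq_bigr do rewrite -big_distrr -big_distrr /=.
under [X in _ <= X]eq_bigr do rewrite big_split sum_nat_const /=.
rewrite -big_distrr -big_distrl big_split sum_nat_const -big_distrr /=; lia.
Qed.

Local Open Scope ring_scope.

(** [D] and [B] are the sums of d and its square over the [x] vertices outside the tree; [N] and [c]
    are the sums of squares and of binomials on the last level. The denominator with [c] in place of
    the maximum is exactly [B], so a lower bound on [c] suffices. *)
Lemma excess_ratio_le (D B N c x a S P Q : nat) : (0 < Q)%N ->
  (D + a = P)%N -> (B + N + 2 * a = S + P)%N -> (N = 2 * c + a)%N ->
  (D ^ 2 <= x * B)%N -> (a ^ 2 <= Q * N)%N ->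
  (P%:R - a%:R) ^+ 2 / (S%:R - 3 * a%:R + P%:R
     - 2 * (Num.max 0 (Num.ceil (a%:R ^+ 2 / (2 * Q%:R) - a%:R / 2 : rat)))%:~R)
    <= x%:R :> rat.
Proof.
move=> Q_gt0 eqP eqS eqN leD leA.
set m := Num.max _ _.
have QR_gt0 : 0 < Q%:R :> rat by rewrite ltr0n.
have le_m : (m%:~R : rat) <= c%:R.
  rewrite -[c%:R]/(c%:~R) ler_int ge_max lez_nat leq0n /= ceil_le_int.
  rewrite lerBlDr ler_pdivrMr ?mulr_gt0 //.
  have : (a%:R ^+ 2 <= Q%:R * N%:R :> rat) by rewrite -natrX -natrM ler_nat.
  rewrite eqN natrD natrM; nra.
have eqPR : D%:R + a%:R = P%:R :> rat by rewrite -natrD eqP.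
have eqSR : B%:R + N%:R + 2 * a%:R = S%:R + P%:R :> rat by rewrite -!natrD -natrM -eqS !natrD.
have eqNR : N%:R = 2 * c%:R + a%:R :> rat by rewrite eqN natrD natrM.
set den := (X in _ / X).
have B_ge0 : 0 <= B%:R :> rat by [].
have le_den : B%:R <= den by rewrite /den; lra.
(* For a zero denominator the quotient is 0 by convention. *)
have [den0|den_neq0] := eqVneq den 0; first by rewrite den0 invr0 mulr0.
rewrite ler_pdivrMr ?lt_neqAle 1?eq_sym ?den_neq0 ?(le_trans B_ge0) //.
rewrite -eqPR addrK; apply: (@le_trans _ _ (x%:R * B%:R)).
  by rewrite -natrX -natrM ler_nat.
exact: ler_wpM2l.
Qed.

Theorem theorem4p4 (T : finType) (e : rel T) (k h : nat) (a : seq nat)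
    (e_sym : symmetric e) (e_irr : irreflexive e)
    (e_conn : connected_graph e)
    (k_ge3 : (3 <= k)%N) (e_reg : regular e k)
    (e_girth : has_girth e (2 * h)%N)
    (e_sig : girth_regular_with_signature e (2 * h)%N a) :
  2 * (((k%:R - 1) ^+ h - 1) / (k%:R - 2)) + (max_excess k h a)%:~R
    <= #|T|%:R :> rat.
Proof.
case: e_girth => [[s s_cycle s_size] girth_ge].
(* Girths 0 and 2 are impossible, since a cycle has more than two vertices. *)
case: h e_sig s_size girth_ge => [|[|h]] e_sig s_size girth_ge;
  try by move: s_cycle; rewrite /graph_cycle s_size.
case: k k_ge3 e_reg => // q k_ge3 e_reg.
have [u _] : exists u : T, u \in predT by case: e_conn => /card_gt0P[u _] _; exists u.
pose N := [set w | e u w].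
have size_a : size a = q.+1.
  by rewrite -(e_sig u) size_sort size_map -cardE e_reg.
have sum_a : \sum_(j < q.+1) (nth 0%N a j)%:R =
    (\sum_(w | e u w) cycles_through_edge e (2 * h.+2) u w)%:R :> rat.
  rewrite -natr_sum -size_a -(big_mkord xpredT (nth 0%N a)) -(big_nth 0%N xpredT id).
  rewrite -(e_sig u) (perm_big _ (permEl (perm_sort _ _))) big_map big_enum.
  by congr (_%:R); apply: eq_bigl => w; rewrite inE.
pose t := (\sum_(i < h.+2) 2 * q ^ i)%N.
have excess_le i : (i < q.+1)%N -> excess q.+1 h.+2 a i <= #|T|%:Z - t%:Z.
  move=> lti.
  (* Every entry of the signature is realised by an arc at the one fixed vertex [u]. *)
  have : nth 0%N a i \in [seq cycles_through_edge e (2 * h.+2) u w | w <- enum N].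
    by rewrite -(mem_sort leq) [sort _ _](e_sig u) mem_nth ?size_a.
  case/mapP => v; rewrite mem_enum inE => euv a_i.
  have := cardsC (tree e h u v); rewrite (card_tree e_sym e_irr girth_ge e_reg euv) -/t => cardX.
  have -> : #|T|%:Z - t%:Z = #|~: tree e h u v|%:Z by rewrite -cardX PoszD addrC addKr.
  pose n z := #|branches e h u z :\ v|.
  pose c := (\sum_(z in ends e u v h.+1) 'C(n z, 2))%N.
  have Q_gt0 : (0 < q ^ h.+1)%N by rewrite expn_gt0; case: (q) k_ge3.
  have n_sq : (\sum_(z in ends e u v h.+1) n z ^ 2 =
               2 * c + cycles_through_edge e (2 * h.+2) u v)%N.
    rewrite (cycles_through_edge_branches e_sym e_irr girth_ge euv).
    rewrite big_distrr -big_split; apply: eq_bigr => z _ /=.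
    (* Writing 2 as a factorial turns twice the binomial into [n z * (n z).-1]. *)
    rewrite -/(n z) -[2%N in RHS]/(2`!)%N mulnC bin_ffact ffactnS ffactn1.
    by case: (n z) => //= m; lia.
  have n_CS : (cycles_through_edge e (2 * h.+2) u v ^ 2 <=
               q ^ h.+1 * \sum_(z in ends e u v h.+1) n z ^ 2)%N.
    rewrite (cycles_through_edge_branches e_sym e_irr girth_ge euv).
    by rewrite -(card_last_level e_sym e_irr girth_ge e_reg euv) sum_sqr_le.
  have := excess_ratio_le Q_gt0
    (sum_degrees_outside e_sym e_irr girth_ge e_reg euv)
    (sum_degrees_sq_outside e_sym e_irr girth_ge e_reg euv)
    n_sq (sum_sqr_le _ _) n_CS.
  rewrite /excess a_i sum_a ceil_le_int [_ - 1](_ : _ = q%:R); last by rewrite -natr1 addrK.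
  by rewrite !natrX.
have q1 : (q%:R - 1 : rat) != 0 by rewrite subr_eq0 pnatr_eq1; lia.
have t_eq : 2 * ((q%:R ^+ h.+2 - 1) / (q%:R - 1)) = t%:R :> rat.
  rewrite subrX1 [X in X / _]mulrC mulfK // mulr_sumr natr_sum.
  by apply: eq_bigr => i _; rewrite natrM natrX.
have -> : q.+1%:R - 1 = q%:R :> rat by rewrite -natr1 addrK.
have -> : q.+1%:R - 2 = q%:R - 1 :> rat by rewrite -natr1; ring.
rewrite t_eq addrC -lerBrDr.
have -> : #|T|%:R - t%:R = (#|T|%:Z - t%:Z)%:~R :> rat by rewrite rmorphB.
rewrite ler_int /max_excess.
by elim/big_ind: _ => [|x y le_x le_y|i _]; rewrite ?ge_max ?le_x ?excess_le.
Qed.
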